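(* Let $N$ be a finite non-empty set with $n=|N|$, and let $(\mathcal{X}^{\circ},\subseteq)$ and $(\mathcal{Y}^{\circ},\subseteq)$ be the finite lattices defined by the Galois connections based on the precedence relation $\circ$ between $\Upsilon(N)$ and $N\times N$. (i) If $n\geq 2$ then, for $T\subseteq N\times N$: [$T\in\mathcal{Y}^{\circ}$ and $T\neq N\times N$] if and only if $T$ is a poset on $N$. (ii) For $S\subseteq\Upsilon(N)$: [$S\in\mathcal{X}^{\circ}$ and $S\neq\emptyset$] if and only if there exists a (uniquely determined) poset $(N,\preceq)$ such that $S=\{\varepsilon\in\Upsilon(N): \varepsilon_{-1}(u)<\varepsilon_{-1}(v)\text{ whenever }u\prec v\}$, that is, $S=\mathcal{L}(P)$ for a poset $P$ on $N$. (iii) Any $S\subseteq\Upsilon(N)$ representing a non-empty face of the permutohedron $\Pi(N)$ belongs to $\mathcal{X}^{\circ}$. (iv) The lattice $(\mathcal{X}^{\circ},\subseteq)$ is atomistic, coatomistic, and graded. Moreover, the coatoms in $\mathcal{X}^{\circ}$ are precisely the sets $S_{u\prec v}:=\{\varepsilon\in\Upsilon(N): \varepsilon_{-1}(u)<\varepsilon_{-1}(v)\}$, where $u,v\in N$, $u\neq v$.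
   Context: $[n]=\{1,\ldots,n\}$. An enumeration of $N$ is a bijection $\varepsilon:[n]\to N$, with inverse $\varepsilon_{-1}:N\to[n]$; $\Upsilon(N)$ is the set of all enumerations of $N$. A poset on $N$ is a reflexive, antisymmetric, transitive relation $P\subseteq N\times N$; $u\prec v$ means $(u,v)\in P$ and $u\neq v$. The precedence relation $\circ$ between $X=\Upsilon(N)$ and $Y=N\times N$ is: $\varepsilon\circ(u,v)$ iff $\varepsilon_{-1}(u)\leq\varepsilon_{-1}(v)$. For $S\subseteq X$ put $S^{\rhd}=\{(u,v)\in Y:\varepsilon\circ(u,v)\text{ for every }\varepsilon\in S\}$; for $T\subseteq Y$ put $\mathcal{L}(T)=T^{\lhd}=\{\varepsilon\in X:\varepsilon\circ(u,v)\text{ for every }(u,v)\in T\}$. Then $\mathcal{X}^{\circ}=\{T^{\lhd}:T\subseteq Y\}$ and $\mathcal{Y}^{\circ}=\{S^{\rhd}:S\subseteq X\}$, both ordered by inclusion; these are finite lattices. The rank vector of $\varepsilon\in\Upsilon(N)$ is $\rho_{\varepsilon}=[\varepsilon_{-1}(u)]_{u\in N}\in\mathbb{R}^{N}$; the permutohedron is $\Pi(N)=\mathrm{conv}\{\rho_{\varepsilon}:\varepsilon\in\Upsilon(N)\}$. The set $S\subseteq\Upsilon(N)$ representing a non-empty face $F$ of $\Pi(N)$ is the set of those $\varepsilon$ for which $\rho_{\varepsilon}$ is a vertex of $F$. It is a known fact that these are exactly the following sets: for an ordered partition $|A_1|\ldots|A_m|$ ($1\leq m\leq n$) of $N$ into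 non-empty blocks, the set of all enumerations that list first all elements of $A_1$, then all elements of $A_2$, and so on. In a finite lattice, atoms are the elements covering the least element and coatoms are the elements covered by the greatest element. The lattice is atomistic (coatomistic) if every element is the join of a set of atoms (the meet of a set of coatoms), the empty join (meet) being the least (greatest) element. A poset $(L,\preceq)$ is graded if there is $h:L\to\mathbb{Z}$ such that $l\prec u$ implies $h(l)<h(u)$, and $h(u)=h(l)+1$ whenever $u$ covers $l$. *)

(* Defs.v *)
From HB Require Import structures.
From mathcomp Require Import all_boot all_order all_algebra.

Set Implicit Arguments.
Unset Strict Implicit.
Unset Printing Implicit Defensive.

Import Order.TTheory GRing.Theory Num.Theory.

Section FiniteOrder.
Local Open Scope order_scope.

(* covers u l means that u covers l. *)
Definition covers (d : Order.disp_t) (L : finPOrderType d) (u l : L) : bool :=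
  (l < u) && ~~ [exists z : L, (l < z) && (z < u)].

Definition atom (d : Order.disp_t) (L : finTBLatticeType d) (a : L) : bool :=
  covers a \bot.

Definition coatom (d : Order.disp_t) (L : finTBLatticeType d) (c : L) : bool :=
  covers \top c.

Definition atomistic (d : Order.disp_t) (L : finTBLatticeType d) : Prop :=
  forall x : L, exists A : {set L},
    (forall a, a \in A -> atom a) /\ x = \join_(a in A) a.

Definition coatomistic (d : Order.disp_t) (L : finTBLatticeType d) : Prop :=
  forall x : L, exists A : {set L},
    (forall c, c \in A -> coatom c) /\ x = \meet_(c in A) c.

Definition graded (d : Order.disp_t) (L : finPOrderType d) : Prop :=
  exists h : L -> int,
    (forall l u : L, l < u -> (h l < h u)%R) /\
    (forall l u : L, covers u l -> h u = (h l + 1)%R).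

End FiniteOrder.

(* For a relation r between A and B, polar r S is the set of all b related to
   every a in S.  The other polarity of the Galois connection is the polar of
   the transposed relation. *)
Section Galois.
Variables A B : finType.

Definition polar (r : A -> B -> bool) (S : {set A}) : {set B} :=
  [set b | [forall a in S, r a b]].

Definition polars (r : A -> B -> bool) : {set {set B}} :=
  [set polar r S | S : {set A}].

Definition galois_lattice (r : A -> B -> bool) : predArgType :=
  {T : {set B} | T \in polars r}.

HB.instance Definition _ (r : A -> B -> bool) :=
  SubFinite.on (galois_lattice r).

End Galois.

Section GaloisLattice.
Variables (A B : finType) (r : A -> B -> bool).
Local Notation L := (galois_lattice r).
Local Notation up := (polar (fun b a => r a b)).

Let polar_in (S : {set A}) : polar r S \in polars r.
Proof. exact: imset_f. Qed.

Definition to_galois (S : {set A}) : L := Sub (polar r S) (polar_in S).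

Let polarS (S S' : {set A}) : S \subset S' -> polar r S' \subset polar r S.
Proof.
move=> sSS'; apply/subsetP => b; rewrite !inE => /forall_inP h.
by apply/forall_inP => a /(subsetP sSS') /h.
Qed.

Let polar_adj (S : {set A}) (T : {set B}) :
  (T \subset polar r S) = (S \subset up T).
Proof.
apply/subsetP/subsetP => h x /[dup] xS _.
  rewrite inE; apply/forall_inP => b /h.
  by rewrite inE => /forall_inP; apply.
rewrite inE; apply/forall_inP => a /h.
by rewrite inE => /forall_inP; apply.
Qed.

Let val_polar (x : L) : exists S, val x = polar r S.
Proof. by case/imsetP: (valP x) => S _ ->; exists S. Qed.

Let polarK (x : L) : polar r (up (val x)) = val x.
Proof.
have [S ->] := val_polar x; apply/eqP; rewrite eqEsubset.
by rewrite polarS -?polar_adj //= polar_adj.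
Qed.

Definition gle (x y : L) : bool := val x \subset val y.

Let gle_refl : reflexive gle. Proof. by move=> x; apply: subxx. Qed.
Let gle_anti : antisymmetric gle.
Proof. by move=> x y h; apply/val_inj/eqP; rewrite eqEsubset. Qed.
Let gle_trans : transitive gle.
Proof. by move=> y x z; apply: subset_trans. Qed.

Fact galois_display : Order.disp_t. Proof. exact: Order.Disp tt tt. Qed.

HB.instance Definition _ :=
  Order.Le_isPOrder.Build galois_display L gle_refl gle_anti gle_trans.

Definition gmeet (x y : L) : L := to_galois (up (val x) :|: up (val y)).
Definition gjoin (x y : L) : L := to_galois (up (val x :|: val y)).

Let polarU (S S' : {set A}) : polar r (S :|: S') = polar r S :&: polar r S'.
Proof.
apply/setP=> b; rewrite !inE; apply/forall_inP/andP => [h|[/forall_inP h /forall_inP h'] a].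
  by split; apply/forall_inP => a aS; apply: h; rewrite inE aS ?orbT.
by rewrite inE => /orP[/h|/h'].
Qed.

Lemma val_gle (x y : L) : (x <= y)%O = (val x \subset val y).
Proof. by []. Qed.

Lemma val_gmeet (x y : L) : val (gmeet x y) = val x :&: val y.
Proof. by rewrite /= polarU !polarK. Qed.

Let gjoinP (x y z : L) : (gjoin x y <= z)%O = (x <= z)%O && (y <= z)%O.
Proof.
rewrite !val_gle /= -subUset; have [S ->] := val_polar z.
apply/idP/idP => [|h].
  by apply: subset_trans; rewrite polar_adj.
by apply: polarS; rewrite -polar_adj.
Qed.

Let gmeetP (x y z : L) : (x <= gmeet y z)%O = (x <= y)%O && (x <= z)%O.
Proof. by rewrite !val_gle val_gmeet subsetI. Qed.

HB.instance Definition _ := Order.POrder_MeetJoin_isLattice.Build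
  galois_display L gmeetP gjoinP.

Let gbotP (x : L) : (to_galois [set: A] <= x)%O.
Proof.
by have [S xE] := val_polar x; rewrite val_gle xE polarS ?subsetT.
Qed.

Let gtopP (x : L) : (x <= to_galois set0)%O.
Proof.
rewrite val_gle /=; apply/subsetP => b _.
by rewrite inE; apply/forall_inP => a; rewrite inE.
Qed.

HB.instance Definition _ := Order.hasBottom.Build galois_display L gbotP.
HB.instance Definition _ := Order.hasTop.Build galois_display L gtopP.

End GaloisLattice.

(* 'I_#|N| is {0, ..., n-1}, so enumerations are indexed from 0 and [position]
   shifts the inverse back to {1, ..., n}. *)
Definition enumeration (N : finType) : predArgType :=
  {e : {ffun 'I_#|N| -> N} | injectiveb e && [forall u, u \in codom e]}.

HB.instance Definition _ (N : finType) := SubFinite.on (enumeration N).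

Lemma enumeration_codom (N : finType) (e : enumeration N) (u : N) :
  u \in codom (val e).
Proof. by case/andP: (valP e) => _ /forallP. Qed.

Definition position (N : finType) (e : enumeration N) (u : N) : nat :=
  (iinv (enumeration_codom e u)).+1.

Definition precedes (N : finType) (e : enumeration N) (uv : N * N) : bool :=
  position e uv.1 <= position e uv.2.

Definition preceded (N : finType) (uv : N * N) (e : enumeration N) : bool :=
  precedes e uv.

Definition Xcirc (N : finType) : {set {set enumeration N}} :=
  polars (@preceded N).

Definition Ycirc (N : finType) : {set {set N * N}} := polars (@precedes N).

Definition calL (N : finType) (T : {set N * N}) : {set enumeration N} :=
  polar (@preceded N) T.

Definition Xlattice (N : finType) : finTBLatticeType galois_display :=
  galois_lattice (@preceded N).

Definition is_poset (N : finType) (P : {set N * N}) : Prop :=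
  let leP := fun u v : N => (u, v) \in P in
  [/\ reflexive leP, antisymmetric leP & transitive leP].

Definition linear_extensions (N : finType) (P : {set N * N}) :
    {set enumeration N} :=
  [set e : enumeration N | [forall u, forall v,
     ((u, v) \in P) && (u != v) ==> (position e u < position e v)]].

Definition S_prec (N : finType) (u v : N) : {set enumeration N} :=
  [set e : enumeration N | position e u < position e v].

(* Imported only here: classical_sets reuses the finset names set0, setT, ... *)
From mathcomp Require Import boolp classical_sets reals convex.

Section Permutohedron.
Local Open Scope classical_set_scope.
Local Open Scope ring_scope.
Variables (R : realType) (N : finType).

(* R^o is R as a module over itself, which makes R^N an lmodType R. *)
Local Notation RN := {ffun N -> R^o}.

Definition convex_hull (A : set RN) : set RN :=
  smallest (@convex_set R RN) A.

Definition rank_vector (e : enumeration N) : RN :=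
  [ffun u => (position e u)%:R].

Definition permutohedron : set RN :=
  convex_hull (range rank_vector).

(* A face is cut out by a valid linear inequality; the zero functional gives
   the improper faces P and set0. *)
Definition is_face (P F : set RN) : Prop :=
  exists (a : RN) (b : R),
    (forall x, P x -> \sum_u a u * x u <= b) /\
    F = [set x | P x /\ \sum_u a u * x u = b].

Definition is_vertex (F : set RN) (x : RN) : Prop :=
  is_face F [set x].

Definition represents_face (S : {set enumeration N}) (F : set RN) :
    Prop :=
  forall e, e \in S <-> is_vertex F (rank_vector e).

Definition represents_nonempty_face (S : {set enumeration N}) : Prop :=
  exists F, [/\ is_face permutohedron F, F !=set0 & represents_face S F].

End Permutohedron.

(* Main.v *)
Require Import Defs.
From mathcomp Require Import all_boot all_order all_algebra reals.
From mathcomp Require Import perm interval_inference ring lra.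
From mathcomp Require classical_sets convex.

(* A poset is the intersection of its linear extensions: if [u <= v] fails in
   [P], then adding [v < u] to [P] and closing transitively gives a poset, and
   sorting [N] by the sizes of its principal ideals lists [v] before [u].
   Hence the Galois connection restricts to an anti-isomorphism between posets
   and nonempty closed sets of enumerations.  If [P] is properly contained in
   [Q], then deleting from [Q] a covering pair outside [P] leaves a poset, so
   minus the number of pairs is a rank function, the empty set being placed
   just below the linear orders.  Finally, a nonempty face of the permutohedron
   is the set of maximizers of some linear functional [a], and the rank vectors
   maximizing [a] are those of the enumerations sorted by [a]. *)

Set Implicit Arguments.
Unset Strict Implicit.
Unset Printing Implicit Defensive.

Import Order.TTheory GRing.Theory Num.Theory.

(** * Polarities of a Galois connection *)

Section Polar.
Variables (A B : finType) (r : A -> B -> bool).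

Lemma in_polar (S : {set A}) b :
  reflect (forall a, a \in S -> r a b) (b \in polar r S).
Proof. by rewrite inE; apply: forall_inP. Qed.

Lemma polar0 : polar r set0 = setT.
Proof.
by apply/setP => b; rewrite in_setT; apply/in_polar => a; rewrite inE.
Qed.

Lemma polar_in_polars (S : {set A}) : polar r S \in polars r.
Proof. exact: imset_f. Qed.

Lemma polarsP (T : {set B}) :
  reflect (exists S, T = polar r S) (T \in polars r).
Proof.
by apply: (iffP imsetP) => [[S _ ->]|[S ->]]; exists S; rewrite ?inE.
Qed.

Lemma polarS (S S' : {set A}) : S \subset S' -> polar r S' \subset polar r S.
Proof.
move=> sSS'; apply/subsetP => b /in_polar h; apply/in_polar => a.
by move/(subsetP sSS')/h.
Qed.

End Polar.

(** Both inclusions say that every element of [S] is related to every element of [T]. *)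
Lemma polar_adj (A B : finType) (r : A -> B -> bool)
    (S : {set A}) (T : {set B}) :
  (T \subset polar r S) = (S \subset polar (fun b a => r a b) T).
Proof.
apply/subsetP/subsetP => h x xS; apply/in_polar => b /h /in_polar; exact.
Qed.

Lemma polarK (A B : finType) (r : A -> B -> bool) (T : {set B}) :
  T \in polars r -> polar r (polar (fun b a => r a b) T) = T.
Proof.
case/polarsP => S ->; apply/eqP; rewrite eqEsubset; apply/andP; split.
  by apply: polarS; rewrite -(polar_adj r).
by rewrite (polar_adj r).
Qed.

(** * Enumerations and the total orders they induce *)

Section Enumerations.
Variable N : finType.
Implicit Types (e f g : enumeration N) (u v : N) (P Q : {set N * N}).
Implicit Types S : {set enumeration N}.

Lemma position_at e (i : 'I_#|N|) : position e (val e i) = i.+1.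
Proof.
rewrite /position; have/andP[/injectiveP inj _] := valP e.
congr (nat_of_ord _).+1; apply: inj; exact: f_iinv.
Qed.

Lemma positionP e u : exists2 i, u = val e i & position e u = i.+1.
Proof.
exists (iinv (enumeration_codom e u)) => //; by rewrite f_iinv.
Qed.

Lemma position_inj e : injective (position e).
Proof.
move=> u v; have [i -> ->] := positionP e u; have [j -> ->] := positionP e v.
by case=> /val_inj ->.
Qed.

Lemma position_neq e u v : u != v -> (position e u == position e v) = false.
Proof. by move=> uv; apply: contraNF uv => /eqP/position_inj ->. Qed.

Lemma position_lt e u v :
  u != v -> (position e u < position e v) = (position e u <= position e v).
Proof. by move=> uv; rewrite [RHS]leq_eqVlt position_neq. Qed.

Lemma sum_position (R : nmodType) e (F : N -> nat -> R) :
  (\sum_u F u (position e u) = \sum_(i < #|N|) F (val e i) i.+1)%R.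
Proof.
have bij : bijective (val e).
  exists (fun u => iinv (enumeration_codom e u)) => [i|u]; last exact: f_iinv.
  have/andP[/injectiveP inj _] := valP e; apply: inj; exact: f_iinv.
rewrite (reindex (val e)) /=; last exact: onW_bij.
by apply: eq_bigr => i _; rewrite position_at.
Qed.

Lemma enumeration_ext e f : position e =1 position f -> e = f.
Proof.
move=> ef; apply/val_inj/ffunP => i.
by apply: (@position_inj f); rewrite -ef !position_at.
Qed.

Definition order_of e : {set N * N} := [set uv | precedes e uv].

Lemma in_order_of e u v :
  ((u, v) \in order_of e) = (position e u <= position e v).
Proof. by rewrite inE. Qed.

Lemma in_calL P e :
  reflect (forall u v, (u, v) \in P -> position e u <= position e v)
          (e \in calL P).
Proof.
apply: (iffP (@in_polar _ _ (@preceded N) P e)) => [h u v /h //|h [u v]].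
exact: h.
Qed.

Lemma calL_subset P e : (e \in calL P) = (P \subset order_of e).
Proof.
apply/in_calL/subsetP => [h [u v] /h|h u v /h]; by rewrite in_order_of.
Qed.

Lemma linear_extensionsE P : linear_extensions P = calL P.
Proof.
apply/setP => e; rewrite inE; apply/forallP/in_calL => [h u v uvP|h u].
  have [<-//|uv] := eqVneq u v.
  by have /forallP/(_ v) := h u; rewrite uvP uv => /ltnW.
by apply/forallP => v; apply/implyP => /andP[/h +  uv]; rewrite position_lt.
Qed.

(** Each [order_of g] is the image of one and the same set of index pairs under an injection. *)
Lemma card_order_of e f : #|order_of e| = #|order_of f|.
Proof.
suff E : forall g, order_of g =
    [set (val g ij.1, val g ij.2)
      | ij in [set ij : 'I_#|N| * 'I_#|N| | ij.1 <= ij.2]].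
  have inj g :
      injective (fun ij : 'I_#|N| * 'I_#|N| => (val g ij.1, val g ij.2)).
    have/andP[/injectiveP inj _] := valP g.
    by move=> [i j] [i' j'] [/inj /= -> /inj ->].
  by rewrite (E e) (E f) !card_imset.
move=> g; apply/setP => -[u v]; rewrite in_order_of.
apply/idP/imsetP => [|[[i j]]].
  have [i -> ->] := positionP g u; have [j -> ->] := positionP g v.
  by move=> ij; exists (i, j); rewrite ?inE.
by rewrite inE /= => ij [-> ->]; rewrite !position_at.
Qed.

(** The position of [v] is the size of its principal ideal, so the total order determines the
    enumeration. *)
Lemma position_card e v : position e v = #|[set u | (u, v) \in order_of e]|.
Proof.
have [j -> ->] := positionP e v.
have -> : [set u | (u, val e j) \in order_of e]
        = [set val e (widen_ord (ltn_ord j) i) | i : 'I_j.+1].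
  apply/setP => u; rewrite inE in_order_of position_at.
  apply/idP/imsetP => [|[i _ ->]]; last by rewrite position_at /=.
  have [i -> ->] := positionP e u; move=> ij.
  by exists (Ordinal ij) => //; congr (val e _); apply: val_inj.
rewrite card_imset ?card_ord // => i i'.
by have/andP[/injectiveP inj _] := valP e => /inj/(congr1 val)/= /val_inj.
Qed.

Lemma order_of_inj : injective order_of.
Proof.
by move=> e f ef; apply: enumeration_ext => v; rewrite !position_card ef.
Qed.

(** Total orders of enumerations all have the same number of pairs, so an inclusion between two of
    them is an equality. *)
Lemma calL_order_of e : calL (order_of e) = [set e].
Proof.
apply/setP => f; rewrite calL_subset inE; apply/idP/eqP => [sub|-> //].
by apply/esym/order_of_inj/eqP; rewrite eqEcard sub (card_order_of f e) leqnn.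
Qed.

(** * Linear extensions of a poset *)

Lemma exists_enumeration_height (h : N -> nat) :
  exists e, forall u v, h u < h v -> position e u < position e v.
Proof.
pose hle := relpre h leq.
have sz : size (sort hle (enum N)) == #|N| by rewrite size_sort cardE.
pose t : #|N|.-tuple N := Tuple sz.
have tuniq : uniq t by rewrite sort_uniq enum_uniq.
have tE : injectiveb [ffun i => tnth t i]
          && [forall u, u \in codom [ffun i => tnth t i]].
  apply/andP; split.
    by apply/injectiveP => i j; rewrite !ffunE => /(tuple_uniqP _ tuniq).
  apply/forallP => u; have /tnthP[i ->] : u \in t by rewrite mem_sort mem_enum.
  by apply/codomP; exists i; rewrite ffunE.
pose e : enumeration N := exist _ [ffun i => tnth t i] tE; exists e => u v.
have [i -> ->] := positionP e u; have [j -> ->] := positionP e v.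
rewrite /= !ffunE !ltnS ltnNge; apply: contraNltn => ji.
have hle_trans : transitive hle by move=> ? ? ?; apply: leq_trans.
have x0 : N := tnth t i.
rewrite !(tnth_nth x0); apply: (sorted_leq_nth hle_trans) => //.
- by move=> x; apply: leqnn.
- by apply: sort_sorted => x y; apply: leq_total.
- by rewrite inE size_tuple.
- by rewrite inE size_tuple.
Qed.

Lemma exists_linear_extension_gt P u v :
    is_poset P -> (u, v) \notin P ->
  exists2 e, e \in calL P & position e v < position e u.
Proof.
move=> [Prefl Panti Ptr] uvP.
have Pt x y z : (x, y) \in P -> (y, z) \in P -> (x, z) \in P.
  exact: (Ptr y x z).
have Pr x : (x, x) \in P by apply: Prefl.
(* [Q] is the transitive closure of [P] with the pair [(v, u)] added. A chain using the new pair
   twice would put [(u, v)] in [P]. *)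
pose Q x y := ((x, y) \in P) || ((x, v) \in P) && ((u, y) \in P).
have Qrefl x : Q x x by rewrite /Q Pr.
have Qtr x y z : Q x y -> Q y z -> Q x z.
  rewrite /Q => /orP[xy|/andP[xv uy]] /orP[yz|/andP[yv uz]].
  - by rewrite (Pt _ _ _ xy yz).
  - by rewrite uz (Pt _ _ _ xy yv) orbT.
  - by rewrite xv (Pt _ _ _ uy yz) orbT.
  - by rewrite (Pt _ _ _ uy yv) in uvP.
have Qanti x y : Q x y -> Q y x -> x = y.
  rewrite /Q => /orP[xy|/andP[xv uy]] /orP[yx|/andP[yv ux]].
  - by apply: Panti; apply/andP.
  - by case/negP: uvP; apply: Pt ux (Pt _ _ _ xy yv).
  - by case/negP: uvP; apply: Pt uy (Pt _ _ _ yx xv).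
  - by case/negP: uvP; apply: Pt ux xv.
(* Principal ideals of [Q] grow strictly along [Q], so their sizes serve as heights. *)
have [e he] := exists_enumeration_height (fun x => #|[set y | Q y x]|).
have Qe x y : Q x y -> x != y -> position e x < position e y.
  move=> xy nxy; apply/he/proper_card/properP; split.
    by apply/subsetP => z; rewrite !inE => /Qtr; apply.
  exists y; rewrite inE ?Qrefl //; apply: contra nxy => yx.
  by apply/eqP/Qanti.
exists e.
  apply/in_calL => x y xy; have [->//|nxy] := eqVneq x y.
  by apply/ltnW/Qe => //; rewrite /Q xy.
apply: Qe; first by rewrite /Q !Pr orbT.
by apply: contraNneq uvP => ->.
Qed.

(** * Posets as the closed sets of the Galois connection *)

Definition common_order (S : {set enumeration N}) := polar (@precedes N) S.

Lemma in_common_order S u v :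
  reflect (forall e, e \in S -> position e u <= position e v)
          ((u, v) \in common_order S).
Proof. exact: in_polar. Qed.

Lemma common_order_calL P : is_poset P -> common_order (calL P) = P.
Proof.
move=> Pp; apply/eqP; rewrite eqEsubset; apply/andP; split; last first.
  by rewrite polar_adj.
apply/subsetP => -[u v] /in_common_order h; apply/negPn/negP.
by case/(exists_linear_extension_gt Pp) => e /h; rewrite leqNgt => /negP.
Qed.

Lemma calL_common_order S : S \in Xcirc N -> calL (common_order S) = S.
Proof. exact: polarK. Qed.

Lemma common_order_poset S : S <> set0 -> is_poset (common_order S).
Proof.
case/eqP/set0Pn => f fS; split => [u|u v|v u w].
- by apply/in_common_order => e _.
- case/andP => /in_common_order/(_ _ fS) uv /in_common_order/(_ _ fS) vu.
  by apply: (@position_inj f); apply/eqP; rewrite eqn_leq uv vu.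
- move=> /in_common_order h /in_common_order h'; apply/in_common_order => e eS.
  exact: leq_trans (h _ eS) (h' _ eS).
Qed.

(** If [calL P] were empty, its common order [P] would contain all pairs; antisymmetry would then
    identify all elements, and any enumeration would lie in [calL P]. *)
Lemma calL_neq0 P : is_poset P -> calL P <> set0.
Proof.
move=> Pp L0.
have [_ Panti _] := Pp; have := common_order_calL Pp.
rewrite L0 /common_order polar0 => PT.
have [e _] := exists_enumeration_height (fun=> 0).
suff: e \in calL P by rewrite L0 inE.
apply/in_calL => u v _; suff -> : u = v by [].
by apply: Panti; rewrite -PT !inE.
Qed.

Lemma calL_subset_calL P Q :
  is_poset P -> (calL P \subset calL Q) = (Q \subset P).
Proof.
move=> Pp; rewrite -{2}(common_order_calL Pp) polar_adj //.
Qed.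

Lemma Ycirc_poset :
  1 < #|N| -> forall T : {set N * N},
  (T \in Ycirc N) /\ T <> setT <-> is_poset T.
Proof.
case/card_gt1P => x [y [_ _ xy]] T; split => [[/polarsP[S ->] ST]|Tp].
  by apply: common_order_poset => S0; apply: ST; rewrite S0 polar0.
split; first by rewrite -(common_order_calL Tp) polar_in_polars.
by move=> TT; case: Tp => _ /(_ x y) anti _; case/eqP: xy; apply: anti;
  rewrite TT !inE.
Qed.

Lemma Xcirc_linear_extensions S :
  (S \in Xcirc N) /\ S <> set0 <->
  exists P, is_poset P /\ S = linear_extensions P.
Proof.
split => [[SX S0]|[P [Pp ->]]].
  exists (common_order S); split; first exact: common_order_poset.
  by rewrite linear_extensionsE calL_common_order.
rewrite linear_extensionsE; split; [exact: polar_in_polars|exact: calL_neq0].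
Qed.

Lemma linear_extensions_inj P Q :
  is_poset P -> is_poset Q ->
  linear_extensions P = linear_extensions Q -> P = Q.
Proof.
move=> Pp Qp; rewrite !linear_extensionsE => PQ.
by rewrite -(common_order_calL Pp) PQ common_order_calL.
Qed.

(* The removed pair is a covering pair of [Q] outside [P]: it is found by
   minimizing the size of its [Q]-interval. *)
Lemma poset_remove_pair P Q : is_poset P -> is_poset Q -> P \proper Q ->
  exists uv, [/\ uv \in Q, uv \notin P & is_poset (Q :\ uv)].
Proof.
move=> [Pr _ Pt] [Qrefl Qa Qt] /properP[PQ [uv0 uv0Q uv0P]].
have Qr x : (x, x) \in Q by apply: Qrefl.
pose I (uv : N * N) := [set w | ((uv.1, w) \in Q) && ((w, uv.2) \in Q)].
have uv0D : uv0 \in Q :\: P by rewrite inE uv0P.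
have [[u v]] := arg_minnP (fun uv => #|I uv|) uv0D.
move=> /setDP[uvQ uvP] uvmin; exists (u, v); split => //.
have between w : (u, w) \in Q -> (w, v) \in Q -> w = u \/ w = v.
  move=> uw wv; have [->|wu] := eqVneq w u; first by left.
  have [->|nwv] := eqVneq w v; first by right.
  (* By minimality of the interval of [(u, v)], a pair with a strictly smaller interval lies in [P].
     An element [w] strictly between would thus give [(u, w)] and [(w, v)] in [P], hence [(u, v)] in
     [P]. *)
  have small a b : (a, b) \in Q -> I (a, b) \proper I (u, v) -> (a, b) \in P.
    move=> abQ /proper_card; rewrite ltnNge => lt.
    by apply: contraNT lt => abP; apply: uvmin; apply/setDP.
  case/negP: uvP; apply: (Pt w); apply: small => //; apply/properP; split.
  - apply/subsetP => z; rewrite !inE /= => /andP[-> zw].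
    exact: Qt zw wv.
  - exists v; rewrite !inE /= ?uvQ ?Qr // negb_and.
    apply/orP; right; apply: contra nwv => vw.
    by apply/eqP/Qa; rewrite wv.
  - apply/subsetP => z; rewrite !inE /= => /andP[wz ->].
    by rewrite (Qt _ _ _ uw wz).
  - exists u; rewrite !inE /= ?uvQ ?Qr // negb_and.
    apply/orP; left; apply: contra wu => wu.
    by apply/eqP/Qa; rewrite wu.
split => [x|x y /andP[]|y x z].
- rewrite !inE Qr andbT; apply: contraNneq uvP => -[<- <-]; exact: Pr.
- by rewrite !inE => /andP[_ xy] /andP[_ yx]; apply: Qa; rewrite xy.
- rewrite !inE => /andP[nxy xy] /andP[nyz yz]; rewrite (Qt _ _ _ xy yz) andbT.
  apply/eqP => -[xu zv]; rewrite xu in xy nxy; rewrite zv in yz nyz.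
  by case: (between y xy yz) => yE; rewrite yE eqxx in nxy nyz.
Qed.

End Enumerations.

(** * Atoms, coatoms and the grading of the lattice of enumeration sets *)

Section XLattice.
Variable N : finType.
Implicit Types (x y : Xlattice N) (e : enumeration N) (u v : N).
Local Notation X := (Xlattice N).

Definition toX (T : {set N * N}) : X := to_galois (@preceded N) T.

Lemma val_toX T : val (toX T) = calL T. Proof. by []. Qed.

Lemma leX x y : (x <= y)%O = (val x \subset val y). Proof. by []. Qed.

Lemma ltX x y : (x < y)%O = (val x \proper val y).
Proof. by rewrite lt_leAnge !leX. Qed.

Lemma val_top : val (\top%O : X) = setT.
Proof.
apply/setP => e; rewrite in_setT; apply/in_polar => uv; by rewrite inE.
Qed.

Lemma val_toX_order_of e : val (toX (order_of e)) = [set e].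
Proof. by rewrite val_toX calL_order_of. Qed.

Lemma Xlattice_atomistic : atomistic X.
Proof.
move=> x; exists [set a | atom a && (a <= x)%O].
split=> [a|]; first by rewrite inE => /andP[].
apply/eqP; rewrite eq_le; apply/andP; split; last first.
  by apply/joinsP => a; rewrite inE => /andP[].
rewrite leX; apply/subsetP => e ex.
suff: (toX (order_of e) <= \join_(a in [set a | atom a && (a <= x)]) a)%O.
  by rewrite leX val_toX_order_of sub1set.
(* If [N] has at most one element, the singleton of [e] is the bottom element and not an atom. *)
have [->|nbot] := eqVneq (toX (order_of e)) \bot%O; first exact: le0x.
apply: (@joins_min _ _ _ (toX (order_of e))) => //.
rewrite inE leX val_toX_order_of sub1set ex andbT.
rewrite /atom /covers lt0x nbot /=; apply/existsP => -[z /andP[]].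
rewrite lt0x => z0; rewrite ltX val_toX_order_of properEcard cards1 ltnS leqn0.
case/andP=> _; rewrite cards_eq0 => /eqP zE; case/eqP: z0; apply/eqP.
by rewrite eq_le le0x andbT leX zE sub0set.
Qed.

(** The common order of the empty set is all of [N * N], in general more than one pair larger than a
    total order. The first branch therefore places the empty set exactly one below the singletons;
    the maximum is just the common size of all total orders. *)
Definition height x : int :=
  if val x == set0 then
    (- (\max_(e : enumeration N) #|order_of e|).+1%:Z)%R
  else (- #|common_order (val x)|%:Z)%R.

Lemma max_card_order_of e :
  \max_(f : enumeration N) #|order_of f| = #|order_of e|.
Proof.
apply/eqP; rewrite eqn_leq leq_bigmax andbT; apply/bigmax_leqP => f _.
by rewrite (card_order_of f e).
Qed.

Lemma common_order1 e : common_order [set e] = order_of e.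
Proof.
apply/setP => -[u v]; rewrite in_order_of.
by apply/in_common_order/idP => [->|h f /set1P->] //; rewrite inE.
Qed.

(** A closed set is recovered from its common order, so strict inclusions remain strict. *)
Lemma common_order_proper x y :
  (x < y)%O -> common_order (val y) \proper common_order (val x).
Proof.
rewrite ltX => /andP[xy nyx]; rewrite properE polarS //=.
apply: contra nyx => sub.
rewrite -(calL_common_order (valP x)) -(calL_common_order (valP y)).
exact: polarS.
Qed.

Lemma Xlattice_graded : graded X.
Proof.
exists height; split => [l u lu|l u /andP[lu /existsP ncov]].
  have [e eu] : exists e, e \in val u.
    by move: lu; rewrite ltX => /properP[_ [e eu _]]; exists e.
  have /negPf u0 : val u != set0 by apply/set0Pn; exists e.
  rewrite /height u0; have [l0|l0] := eqVneq (val l) set0.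
    rewrite ltrN2 ltz_nat (max_card_order_of e) ltnS -common_order1.
    by apply/subset_leq_card/polarS; rewrite sub1set.
  by rewrite ltrN2 ltz_nat; apply/proper_card/common_order_proper.
have [u0|u0] := eqVneq (val u) set0.
  by move: lu; rewrite ltX u0 properE sub0set andbF.
rewrite /height (negPf u0); have [l0|l0] := eqVneq (val l) set0.
  (* An element covering the empty set is a singleton: otherwise the singleton of one of its members
     would lie strictly between. *)
  have /set0Pn[e eu] := u0.
  have -> : val u = [set e].
    apply/eqP; rewrite eq_sym; apply: contra_notT ncov => neu.
    exists (toX (order_of e)).
    rewrite !ltX val_toX_order_of l0 properEneq sub0set eq_sym -cards_eq0 cards1 /=.
    by rewrite properEneq neu sub1set.
  by rewrite common_order1 (max_card_order_of e) -addn1 PoszD opprD subrK.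
move/eqP: u0 => u0; move/eqP: l0 => l0.
have lp := common_order_poset l0; have up := common_order_poset u0.
have pul := common_order_proper lu.
(* Deleting [uv] from the larger poset, that of [l], gives a closed set strictly above [l] and
   contained in [u]; covering forces it to be [u]. *)
have [uv [uvl uvu p]] := poset_remove_pair up lp pul.
suff -> : val u = calL (common_order (val l) :\ uv).
  rewrite common_order_calL // [in RHS](cardsD1 uv) uvl PoszD opprD addrAC.
  by rewrite addNr add0r.
apply/eqP; rewrite eq_sym; apply: contra_notT ncov => neu.
exists (toX (common_order (val l) :\ uv)).
rewrite !ltX val_toX -{1}[val l](calL_common_order (valP l)).
rewrite properE (calL_subset_calL _ lp) (calL_subset_calL _ p) subD1set /=.
apply/andP; split.
  by apply/subsetPn; exists uv; rewrite ?in_setD1 ?eqxx.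
rewrite properEneq neu /=.
have := calL_subset_calL (common_order (val u)) p.
rewrite (calL_common_order (valP u)) => ->.
by rewrite subsetD1 uvu (proper_sub pul).
Qed.

Lemma S_precE u v : u != v -> S_prec u v = calL [set (u, v)].
Proof.
move=> uv; apply/setP => e; rewrite inE position_lt //.
by apply/idP/in_calL => [h x y /set1P[-> ->]|->] //; rewrite inE.
Qed.

Lemma poset_pair u v :
  u != v -> is_poset [set xy | (xy == (u, v)) || (xy.1 == xy.2)].
Proof.
move=> uv; split => [x|x y|y x z]; rewrite !inE /= ?eqxx ?orbT //.
  case/andP=> /orP[/eqP[-> ->]|/eqP//] /orP[/eqP[->]//|/eqP->//].
move=> /orP[/eqP[-> ->]|/eqP-> //] /orP[/eqP[_ ->]|/eqP<-]; by rewrite eqxx.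
Qed.

(** The pair [(u, v)] together with the diagonal is a poset, hence contains every pair respected by
    all members of [S_prec u v]. This makes the sets [S_prec] pairwise incomparable. *)
Lemma S_prec_subset (u v x y : N) :
  u != v -> x != y -> S_prec u v \subset S_prec x y -> (u, v) = (x, y).
Proof.
move=> uv xy sub; have := common_order_calL (poset_pair uv).
move/setP/(_ (x, y)); rewrite inE /= (negPf xy) orbF eq_sym => h.
apply/eqP; rewrite -h; apply/in_common_order => e /in_calL eL.
have: e \in S_prec x y.
  by apply: (subsetP sub); rewrite inE position_lt // eL ?inE ?eqxx.
by rewrite inE => /ltnW.
Qed.

Lemma S_prec_neqT u v : u != v -> S_prec u v != setT.
Proof.
(* The indicator of [u] as height puts [u] last, hence after [v]. *)
move=> uv; have [e he] := exists_enumeration_height (fun w => w == u : nat).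
apply/eqP => /setP/(_ e); rewrite !inE => /ltnW.
by rewrite leqNgt he // eqxx eq_sym (negPf uv).
Qed.

(** If the common order is only the diagonal, it constrains no enumeration and the closed set is
    everything. *)
Lemma neq_top_subset_S_prec x :
  x != \top%O -> exists u v, u != v /\ val x \subset S_prec u v.
Proof.
move=> xT.
have [/forallP h|] := boolP [forall uv in common_order (val x), uv.1 == uv.2].
  case/eqP: xT; apply: val_inj.
  rewrite val_top -[LHS]calL_common_order ?(valP x) //.
  apply/setP => e; rewrite in_setT; apply/in_calL => u v uvx.
  by have := h (u, v); rewrite uvx => /eqP /= ->.
rewrite negb_forall_in => /exists_inP[[u v] /in_common_order /= uvx uv].
exists u, v; split => //; apply/subsetP => e /uvx.
by rewrite inE position_lt.
Qed.

Lemma coatom_S_prec x :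
  reflect (exists u v, u != v /\ val x = S_prec u v) (coatom x).
Proof.
apply: (iffP andP) => [[xT /existsP ncov]|[u [v [uv xE]]]].
  have [|u [v [uv sub]]] := @neq_top_subset_S_prec x; first by rewrite -ltx1.
  exists u, v; split => //; apply/eqP; rewrite eqEsubset sub /=.
  apply: contra_notT ncov => nsub; exists (toX [set (u, v)]).
  rewrite !ltX val_toX -S_precE // val_top properE sub nsub properE subsetT.
  by rewrite subTset S_prec_neqT.
rewrite ltX xE val_top properE subsetT subTset S_prec_neqT //; split => //.
(* A [z] strictly between lies in some [S_prec u' v']; incomparability makes this set [S_prec u v],
   so [z] is not strictly above [x]. *)
apply/existsP => -[z /andP[xz]].
rewrite ltx1 => /neq_top_subset_S_prec[u' [v' [uv' sub]]].
move: xz; rewrite ltX xE properE => /andP[xz /negP]; apply.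
by have [-> ->] := S_prec_subset uv uv' (subset_trans xz sub).
Qed.

(** A closed set is cut out by the pairs of its common order, and each off-diagonal pair contributes
    one coatom. *)
Lemma Xlattice_coatomistic : coatomistic X.
Proof.
move=> x; exists [set c | coatom c && (x <= c)%O].
split=> [c|]; first by rewrite inE => /andP[].
apply/eqP; rewrite eq_le; apply/andP; split.
  by apply/meetsP => c; rewrite inE => /andP[].
rewrite leX -[val x]calL_common_order ?(valP x) //; apply/subsetP => e em.
apply/in_calL => u v uvx; have [->//|uv] := eqVneq u v.
suff: (\meet_(c in [set c | coatom c && (x <= c)]) c <= toX [set (u, v)])%O.
  by rewrite leX => /subsetP/(_ _ em)/in_calL; apply; rewrite inE.
apply: (@meets_max _ _ _ (toX [set (u, v)])) => //.
rewrite inE leX val_toX; apply/andP; split.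
  by apply/coatom_S_prec; exists u, v; rewrite val_toX S_precE.
apply/subsetP => f fx; apply/in_calL => ? ? /set1P[-> ->].
by move/in_common_order: uvx; apply.
Qed.

End XLattice.

(** * Exchanging two elements of an enumeration *)

Section Swap.
Variable N : finType.
Implicit Types (e f : enumeration N) (u v w : N).

Lemma exists_swapped_enumeration e u v :
  exists f, forall w, position f w = position e (tperm u v w).
Proof.
have /andP[/injectiveP inj _] := valP e.
have fP : injectiveb [ffun i => tperm u v (val e i)]
    && [forall w, w \in codom [ffun i => tperm u v (val e i)]].
  apply/andP; split.
    by apply/injectiveP => i j; rewrite !ffunE => /perm_inj/inj.
  apply/forallP => w; have [i wi _] := positionP e (tperm u v w).
  by apply/codomP; exists i; rewrite ffunE -wi tpermK.
pose f : enumeration N := exist _ [ffun i => tperm u v (val e i)] fP.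
exists f => w.
have [i wi ->] := positionP e (tperm u v w).
have -> : w = val f i by rewrite /= ffunE -wi tpermK.
exact: position_at.
Qed.

End Swap.

(** * Faces of the permutohedron as sets of maximizers *)

Section Permutohedron.
Import classical_sets convex.
Local Open Scope classical_set_scope.
Local Open Scope ring_scope.
Variables (R : realType) (N : finType).
Local Notation RN := {ffun N -> R^o}.
Implicit Types (a x y : RN) (e f g : enumeration N).

Definition dot a x : R := \sum_u a u * x u.

Lemma dot_conv a x y (t : {i01 R}) :
  dot a (conv t (x : convex_lmodType RN) y) =
  t%:num * dot a x + (1 - t%:num) * dot a y.
Proof.
rewrite /dot !mulr_sumr -big_split /=; apply: eq_bigr => u _.
rewrite !ffunE /GRing.scale /= /unstable.onem; ring.
Qed.

Lemma convex_halfspace_lt a b : convex_set (M := RN) [set x | dot a x < b].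
Proof.
move=> x y t; rewrite !inE /= dot_conv => xb yb.
have t0 : 0 <= t%:num by [].
have t1 : t%:num <= 1 by [].
have [->|t_neq0] := eqVneq t%:num 0; first by rewrite mul0r add0r subr0 mul1r.
have t_gt0 : 0 < t%:num by rewrite lt_def t_neq0.
nra.
Qed.

Lemma convex_ball c : convex_set (M := RN) [set x | dot x x <= c].
Proof.
move=> x y t; rewrite !inE /= => xc yc.
have t0 : 0 <= t%:num by [].
have t1 : t%:num <= 1 by [].
set z := conv _ _ _.
suff le : dot z z <= t%:num * dot x x + (1 - t%:num) * dot y y.
  by apply: (le_trans le); nra.
rewrite /dot !mulr_sumr -big_split /=; apply: ler_sum => u _.
rewrite /z !ffunE /GRing.scale /=.
rewrite -subr_ge0.
(* The convexity gap of the square, in each coordinate. *)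
have -> : t%:num * (x u * x u) + (1 - t%:num) * (y u * y u)
    - (t%:num * x u + (1 - t%:num) * y u) * (t%:num * x u + (1 - t%:num) * y u)
    = t%:num * (1 - t%:num) * (x u - y u) ^+ 2 by ring.
by apply: mulr_ge0; rewrite ?sqr_ge0 // mulr_ge0 // subr_ge0.
Qed.

(** Reduces a claim about all points of the permutohedron to the rank vectors, once the claim
    defines a convex set. *)
Lemma permutohedron_min (C : set RN) :
  convex_set (M := RN) C -> (forall e, C (rank_vector R e)) ->
  @permutohedron R N `<=` C.
Proof. by move=> cC Ce; apply: smallest_sub => // _ [e _ <-]. Qed.

Lemma rank_vector_permutohedron e : @permutohedron R N (rank_vector R e).
Proof. by apply: sub_gen_smallest; exists e. Qed.

Lemma dot_rank_vector a e :
  dot a (rank_vector R e) = \sum_(i < #|N|) a (val e i) * i.+1%:R.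
Proof.
rewrite -(sum_position e (fun u k => a u * k%:R)).
by apply: eq_bigr => u _; rewrite ffunE.
Qed.

(** The common squared norm of all rank vectors. *)
Definition square_radius : R := \sum_(i < #|N|) i.+1%:R ^+ 2.

Lemma rank_vector_sphere e :
  dot (rank_vector R e) (rank_vector R e) = square_radius.
Proof.
rewrite dot_rank_vector; apply: eq_bigr => i _.
by rewrite ffunE position_at expr2.
Qed.

Lemma permutohedron_ball x : permutohedron x -> dot x x <= square_radius.
Proof.
suff : @permutohedron R N `<=` [set x | dot x x <= square_radius] by apply.
apply: permutohedron_min; first exact: convex_ball.
by move=> e; rewrite /= rank_vector_sphere.
Qed.

Lemma dot_subr x y : dot (x - y) (x - y) = dot x x - dot y x *+ 2 + dot y y.
Proof.
rewrite /dot -sumrMnl -sumrB -big_split /=; apply: eq_bigr => u _.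
rewrite !ffunE; ring.
Qed.

Lemma dot_ge0 x : 0 <= dot x x.
Proof. by apply: sumr_ge0 => u _; rewrite -expr2 sqr_ge0. Qed.

Lemma dot_eq0 x : dot x x <= 0 -> x = 0.
Proof.
move=> x0; have/eqP : dot x x = 0 by apply/le_anti; rewrite x0 dot_ge0.
rewrite psumr_eq0 => [/allP h|u _]; last by rewrite -expr2 sqr_ge0.
apply/ffunP => u; rewrite ffunE.
have := h u (mem_index_enum u); by rewrite /= mulf_eq0 orbb => /eqP.
Qed.

(* All rank vectors lie on a common sphere around the origin, so each of them
   is exposed by its own linear functional. *)
Lemma is_vertex_rank_vector (F : set RN) e :
  F `<=` @permutohedron R N ->
  is_vertex F (rank_vector R e) <-> F (rank_vector R e).
Proof.
move=> FP; split => [[a [b [_ E]]]|Fe].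
  have : [set rank_vector R e] (rank_vector R e) by [].
  by rewrite E => -[].
(* Expanding the squared distance and bounding [dot x x] by [square_radius] shows that the
   functional of [rank_vector R e] is at most [square_radius] on [F], with equality only at that
   vector. *)
have d x : F x -> dot (x - rank_vector R e) (x - rank_vector R e)
    <= (square_radius - dot (rank_vector R e) x) *+ 2.
  move=> /FP/permutohedron_ball xc; rewrite dot_subr rank_vector_sphere; lra.
exists (rank_vector R e), square_radius; split=> [x /d|].
  rewrite -/(dot _ _); have := dot_ge0 (x - rank_vector R e); lra.
apply/seteqP; split=> [_ ->|x [Fx xE]].
  by split; last exact: rank_vector_sphere.
apply/subr0_eq/dot_eq0/(le_trans (d _ Fx)).
by rewrite /dot xE subrr.
Qed.

(** Exchange argument: swapping [u] and [v] when they are out of order raises the value by the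
    product of [a v - a u] and [position e u - position e v], which is positive. *)
Lemma dot_max_sorted a e :
    (forall f, dot a (rank_vector R f) <= dot a (rank_vector R e)) ->
  forall u v, a u < a v -> (position e u <= position e v)%N.
Proof.
move=> emax u v auv; rewrite leqNgt; apply/negP => vu.
have [f fE] := exists_swapped_enumeration e u v.
have uv : v != u by apply: contraTneq auv => ->; rewrite ltxx.
have := emax f; rewrite leNgt => /negP; apply; rewrite -subr_gt0.
rewrite /dot -sumrB (bigD1 u) // (bigD1 v) //= big1 => [|w /andP[wu wv]].
  rewrite !ffunE !fE tpermL tpermR addr0.
  have vu' : (position e v)%:R < (position e u)%:R :> R by rewrite ltr_nat.
  have auv' : (a u : R) < a v by [].
  nra.
by rewrite !ffunE fE tpermD ?subrr // eq_sym.
Qed.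

(** Read along either enumeration, the values of [a] form the same sorted list; only elements with
    equal values can be permuted. *)
Lemma sorted_dot_eq a e f :
    (forall u v, a u < a v -> (position e u <= position e v)%N) ->
    (forall u v, a u < a v -> (position f u <= position f v)%N) ->
  dot a (rank_vector R e) = dot a (rank_vector R f).
Proof.
pose s (g : enumeration N) := [seq (a (val g i) : R) | i <- enum 'I_#|N|].
have srt g : (forall u v, a u < a v -> (position g u <= position g v)%N) ->
    sorted <=%R (s g).
  move=> gs; apply/(sortedP 0) => i; rewrite size_map size_enum_ord => iN.
  have i0 : 'I_#|N| := Ordinal iN.
  rewrite !(nth_map i0) -?enumT ?size_enum_ord ?(ltnW iN) //.
  rewrite leNgt; apply/negP => /gs; rewrite !position_at ltnS.
  by rewrite !nth_enum_ord ?ltnn // ltnW.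
have s_perm g : perm_eq (s g) [seq (a u : R) | u <- enum N].
  have -> : s g = [seq (a u : R) | u <- [seq val g i | i <- enum 'I_#|N|]].
    by rewrite -map_comp.
  have /andP[/injectiveP inj _] := valP g.
  apply/perm_map/uniq_perm.
  - by rewrite (map_inj_uniq inj) enum_uniq.
  - exact: enum_uniq.
  move=> u; rewrite mem_enum; have [i -> _] := positionP g u.
  by rewrite map_f ?mem_enum.
move=> /srt es /srt fs.
have /eq_in_map E : s e = s f.
  apply: (sorted_eq le_trans le_anti) => //.
  by rewrite (permPl (s_perm e)) perm_sym.
rewrite !dot_rank_vector; apply: eq_bigr => i _.
by rewrite (E i) ?mem_enum.
Qed.

Lemma face_in_Xcirc S : represents_nonempty_face R S -> S \in Xcirc N.
Proof.
move=> [_ [[a [b [ab ->]]] [x [Px xb]] Srep]].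
have SE e : e \in S <-> dot a (rank_vector R e) = b.
  apply: (iff_trans (Srep e)); apply: (iff_trans (is_vertex_rank_vector _ _)).
    by move=> ? [].
  by split=> [[]//|eb]; split => //; apply: rank_vector_permutohedron.
have {}ab e : dot a (rank_vector R e) <= b.
  by apply: ab; apply: rank_vector_permutohedron.
(* If no rank vector attained [b], all would lie in an open half-space; by convexity so would the
   permutohedron, contradicting the point [x] of the face. *)
have [f fS] : exists f, f \in S.
  apply/set0Pn; apply/negP => /eqP S0.
  suff /(_ _ Px) : @permutohedron R N `<=` [set x | dot a x < b].
    by rewrite /= /dot xb ltxx.
  apply: permutohedron_min; first exact: convex_halfspace_lt.
  move=> e /=; rewrite lt_neqAle ab andbT; apply/eqP => /SE.
  by rewrite S0 inE.
have srt e : e \in S ->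
    forall u v, a u < a v -> (position e u <= position e v)%N.
  by move=> /SE eb; apply: dot_max_sorted => g; rewrite eb.
(* The level sets of [a], in increasing order, are the blocks of the ordered partition of the face;
   these pairs demand exactly that earlier blocks come first. *)
suff -> : S = calL [set uv | a uv.1 < a uv.2]%SET by apply: polar_in_polars.
apply/setP => e; apply/idP/in_calL => [/srt es u v|es].
  by rewrite inE; apply: es.
apply/SE; rewrite -((SE f).1 fS); apply: sorted_dot_eq; last exact: srt.
by move=> u v auv; apply: es; rewrite inE.
Qed.

End Permutohedron.

Theorem lemma1 (R : realType) (N : finType) (N_gt0 : 0 < #|N|) :
  (* (i) *)
  (1 < #|N| ->
     forall T : {set N * N},
       (T \in Ycirc N) /\ (T <> [set: N * N]) <-> is_poset T) /\
  (* (ii) *)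
  ((forall S : {set enumeration N},
      ((S \in Xcirc N) /\ (S <> set0) <->
         exists P : {set N * N}, is_poset P /\ S = linear_extensions P) /\
      ((S \in Xcirc N) /\ (S <> set0) ->
         exists! P : {set N * N}, is_poset P /\ S = linear_extensions P)) /\
   (forall P : {set N * N}, is_poset P -> linear_extensions P = calL P)) /\
  (* (iii) *)
  (forall S : {set enumeration N},
     represents_nonempty_face R S -> S \in Xcirc N) /\
  (* (iv) *)
  [/\ atomistic (Xlattice N), coatomistic (Xlattice N)
    & graded (Xlattice N)] /\
  (forall S : {set enumeration N},
     (exists C : Xlattice N, coatom C /\ val C = S) <->
     (exists u v : N, u != v /\ S = S_prec u v)).
Proof.
split; first exact: Ycirc_poset.
split.
  split=> [S|P _]; last exact: linear_extensionsE.
  split=> [|/Xcirc_linear_extensions[P [Pp SP]]].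
    exact: Xcirc_linear_extensions.
  exists P; split=> // Q [Qp SQ].
  by apply: linear_extensions_inj => //; rewrite -SP.
split; first exact: face_in_Xcirc.
split.
  split; [exact: Xlattice_atomistic|exact: Xlattice_coatomistic|].
  exact: Xlattice_graded.
move=> S; split=> [[x [/coatom_S_prec[u [v [uv xE]]] <-]]|[u [v [uv ->]]]].
  by exists u, v.
exists (toX [set (u, v)]); rewrite val_toX S_precE //; split=> //.
by apply/coatom_S_prec; exists u, v; rewrite val_toX S_precE.
Qed.
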